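(* Let $M\in\mathbb{R}^{m\times m}$ be symmetric positive semidefinite of rank $p$ with $1<p\le m$, and let $b\in\mathbb{R}^m$ be a vector with nonnegative entries such that either $b=0$ or $b^Tb=1$. Let $S=H_bMH_b^T$, where $H_b=I_m-\frac{\mathbf 1_m b^T}{\mathbf 1_m^T b}$ if $b\neq 0$ and $H_b=I_m$ if $b=0$. Let $\gamma_1\ge\cdots\ge\gamma_q\ge\cdots\ge\gamma_m$ ($\ge 0$) be the eigenvalues of $S$, let $V$ be an arbitrary $q\times q$ orthogonal matrix, let $\Gamma_q=\mathrm{diag}(\gamma_1,\ldots,\gamma_q)$ be the diagonal matrix of the $q$ largest eigenvalues, and let $U_q$ be an $m\times q$ column-orthonormal matrix whose columns are eigenvectors of $S$ corresponding to $\Gamma_q$. Consider $$F(A,\delta)=\mathrm{tr}\big[(S-AA^T-\delta I_m)^2\big],\qquad G(A,\delta)=\log|AA^T+\delta I_m|+\mathrm{tr}\big[(AA^T+\delta I_m)^{-1}S\big],$$ for $\delta>0$ and $A\in\mathbb{R}^{m\times q}$ ($q<\min(m,p)$) of full column rank with $A^Tb=0$. If there exists $j\in\{q+1,\ldots,m\}$ such that $\gamma_q>\gamma_j>0$, then the strict local minimum of $F(A,\delta)$ and of $G(A,\delta)$ with respect to $(A,\delta)$ (under these constraints) is obtained when $$\widehat A=U_q(\Gamma_q-\hat\delta I_q)^{1/2}V\quad\text{and}\quad \hat\delta=\frac{1}{m-q}\sum_{j=q+1}^m\gamma_j .$$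
   Context: $\mathbf 1_m$ is the $m\times 1$ vector of ones, $I_m$ the $m\times m$ identity matrix, $|\cdot|$ the determinant, $\mathrm{tr}$ the trace. When $b=0$ the constraint $A^Tb=0$ is vacuous.
   Formalization: ''Strict local minimum'' is read modulo the arbitrary choice of U_q and V: near the given point the objective is equal at points of the stated form and strictly larger at all other feasible points, since literal strictness fails (rotating V leaves AA^T, F and G unchanged). *)

(* Defs.v *)
From mathcomp Require Import all_boot all_order all_algebra.
From mathcomp Require Import all_classical all_reals all_analysis.

Set Implicit Arguments.
Unset Strict Implicit.
Unset Printing Implicit Defensive.

Import Order.TTheory GRing.Theory Num.Theory.
Import numFieldNormedType.Exports.
Local Open Scope classical_set_scope.
Local Open Scope ring_scope.

Section Matrices.
Variable R : realType.

Definition psdmx (m : nat) (M : 'M[R]_m) : Prop :=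
  M^T = M /\ forall x : 'cV[R]_m, 0 <= (x^T *m M *m x) 0 0.

Definition colorthonormal (m q : nat) (U : 'M[R]_(m, q)) : Prop :=
  U^T *m U = 1%:M.

Definition centering (m : nat) (b : 'cV[R]_m) : 'M[R]_m :=
  let one : 'cV[R]_m := const_mx 1 in
  if b == 0 then 1%:M
  else 1%:M - ((one^T *m b) 0 0)^-1 *: (one *m b^T).

(* Eigenvalues are numbered from 1: only the values gamma 1, ..., gamma m
   matter.  Multiplicities are those of the characteristic polynomial. *)
Definition ordered_eigenvalues (m : nat) (S : 'M[R]_m) (gamma : nat -> R) :
    Prop :=
  char_poly S = \prod_(1 <= i < m.+1) ('X - (gamma i)%:P) /\
  (forall i j, (1 <= i)%N -> (i <= j)%N -> (j <= m)%N -> gamma j <= gamma i).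

Definition Gammaq (q : nat) (gamma : nat -> R) : 'M[R]_q :=
  diag_mx (\row_(i < q) gamma i.+1).

Definition objF (m q : nat) (S : 'M[R]_m) (x : 'M[R]_(m, q) * R) : R :=
  \tr ((S - x.1 *m x.1^T - x.2%:M) ^+ 2).

Definition objG (m q : nat) (S : 'M[R]_m) (x : 'M[R]_(m, q) * R) : R :=
  ln (\det (x.1 *m x.1^T + x.2%:M)) +
  \tr (invmx (x.1 *m x.1^T + x.2%:M) *m S).

Definition feasible (m q : nat) (b : 'cV[R]_m) : set ('M[R]_(m, q) * R) :=
  [set x | [/\ 0 < x.2, \rank x.1 = q & x.1^T *m b = 0]].

Definition deltahat (m q : nat) (gamma : nat -> R) : R :=
  (m - q)%:R^-1 * \sum_(q.+1 <= j < m.+1) gamma j.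

(* The square root is taken entrywise, which for a diagonal matrix with
   nonnegative diagonal is the nonnegative square root of the matrix. *)
Definition Ahat (m q : nat) (gamma : nat -> R)
    (U : 'M[R]_(m, q)) (V : 'M[R]_q) : 'M[R]_(m, q) :=
  U *m map_mx Num.sqrt (Gammaq q gamma - (deltahat m q gamma)%:M) *m V.

Definition top_eigenvectors (m q : nat) (S : 'M[R]_m) (gamma : nat -> R)
    (U : 'M[R]_(m, q)) : Prop :=
  colorthonormal U /\ S *m U = U *m Gammaq q gamma.

Definition solutions (m q : nat) (S : 'M[R]_m) (gamma : nat -> R) :
    set ('M[R]_(m, q) * R) :=
  [set x | exists U : 'M[R]_(m, q), exists V : 'M[R]_q,
     [/\ top_eigenvectors S gamma U, colorthonormal V &
         x = (Ahat gamma U V, deltahat m q gamma)]].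

End Matrices.

(* Strict local minimality at x of f on D, up to the indeterminacy E: near x,
   within D, f is constant on E and strictly larger off E.  For E = [set x]
   this is the usual notion.  It is needed because A |-> A *m V with V
   orthogonal leaves A *m A^T, hence both objectives, unchanged, so that
   minimizers are never isolated when q >= 2; if the q-th and (q+1)-st
   eigenvalues coincide, the eigenvectors can be rotated as well. *)
Definition strict_local_min_modulo (R : realType) (T : topologicalType)
    (D E : set T) (f : T -> R) (x : T) : Prop :=
  [/\ D x, E x &
      \forall y \near x, D y ->
        (E y -> f y = f x) /\ (~ E y -> f x < f y)].

(* Main.v *)
(* Writing a feasible A as W diag(sqrt a) P (singular value decomposition, a
   decreasing and positive) and s_k = (W^T S W)_kk, both objectives split as a
   constant, plus nonnegative one-variable terms in sigma_k = a_k + delta and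
   delta, plus sum_k w_k (gamma_k - s_k), where w_k = 2 a_k for F and
   w_k = 1 / delta - 1 / sigma_k for G.  The one-variable terms vanish exactly
   at sigma_k = gamma_k, delta = deltahat.  Since w is decreasing and positive,
   the last sum is nonnegative by a weighted Ky Fan inequality; when
   sigma_k = gamma_k, it vanishes only if the columns of W are eigenvectors
   for the q largest eigenvalues.  The minimum is therefore even global. *)
Require Import Defs.
From mathcomp Require Import all_boot all_order all_algebra complex ring lra.
From mathcomp Require Import all_classical all_reals all_analysis.

Set Implicit Arguments.
Unset Strict Implicit.
Unset Printing Implicit Defensive.

Import Order.TTheory GRing.Theory Num.Theory.
Import numFieldNormedType.Exports.
Local Open Scope classical_set_scope.
Local Open Scope ring_scope.

(** * Orthogonal diagonalization of real symmetric matrices *)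

Lemma char_poly_conj (R : comUnitRingType) n (P Q A : 'M[R]_n) :
  P *m Q = 1%:M -> char_poly (P *m A *m Q) = char_poly A.
Proof.
move=> PQ; have PQX : map_mx polyC P *m map_mx polyC Q = 1%:M.
  by rewrite -map_mxM PQ map_mx1.
rewrite /char_poly; have -> : char_poly_mx (P *m A *m Q) =
    map_mx polyC P *m char_poly_mx A *m map_mx polyC Q.
  rewrite /char_poly_mx mulmxBr mulmxBl !map_mxM.
  by rewrite (scalar_mxC 'X (map_mx polyC P)) -['X%:M *m _ *m _]mulmxA PQX mulmx1.
by rewrite !det_mulmx mulrAC -det_mulmx PQX det1 mul1r.
Qed.

(** Over the complex closure the matrix becomes Hermitian, so the spectral theorem splits its
    characteristic polynomial with real roots; injectivity of the embedding brings the factorization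
    back to [R]. *)
Lemma symmetric_char_poly_splits (R : rcfType) n (A : 'M[R]_n) :
  A^T = A -> exists d : 'I_n -> R, char_poly A = \prod_i ('X - (d i)%:P).
Proof.
move=> Asym; set f := real_complex R.
have fR x : f x \is Num.real by rewrite complex_real eqxx.
have Bherm : map_mx f A \is hermsymmx.
  apply: realsym_hermsym.
    by apply/is_hermitianmxP; rewrite expr0 scale1r map_mx_id // map_trmx Asym.
  by apply/mxOverP => i j; rewrite mxE.
have Dreal := hermitian_spectral_diag_real Bherm.
have /hermitian_normalmx/orthomx_spectralP Beq := Bherm.
have charB : char_poly (map_mx f A) =
    \prod_i ('X - (spectral_diag (map_mx f A) 0 i)%:P).
  rewrite {1}Beq char_poly_conj ?mulVmx ?spectral_unit //.
  rewrite char_poly_trig ?diag_mx_is_trig //; apply: eq_bigr => i _.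
  by rewrite mxE eqxx.
exists (fun i => complex.Re (spectral_diag (map_mx f A) 0 i)).
apply: (@map_inj_poly _ _ f) => //; first exact: complexI.
rewrite map_char_poly charB rmorph_prod; apply: eq_bigr => i _ /=.
rewrite rmorphB /= map_polyX map_polyC /=; congr ('X - _%:P).
by rewrite /f RRe_real //; apply: (mxOverP Dreal).
Qed.

Lemma symmetric_char_poly_sorted (R : rcfType) n (A : 'M[R]_n) : A^T = A ->
  exists d : nat -> R, char_poly A = \prod_(i < n) ('X - (d i)%:P) /\
    forall i j, (i <= j < n)%N -> d j <= d i.
Proof.
move=> /symmetric_char_poly_splits[d ->].
pose s := sort >=%R (codom d); have sz : size s = n.
  by rewrite size_sort size_codom card_ord.
exists (nth 0 s); split=> [|i j /andP[ij jn]].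
  transitivity (\prod_(x <- s) ('X - x%:P)).
    rewrite (perm_big (codom d)) /=; last by rewrite perm_sort.
    by rewrite /codom /image_mem big_map big_enum.
  by rewrite (big_nth 0) big_mkord sz.
have s_sorted : sorted >=%R s by apply: sort_sorted => x y; exact: le_total.
have ge_trans : transitive (>=%R : rel R).
  by move=> x y z yx zx; exact: le_trans zx yx.
have ge_refl : reflexive (>=%R : rel R) by move=> x; exact: lexx.
apply: (sorted_leq_nth ge_trans ge_refl 0 s_sorted) => //; rewrite !inE sz //.
exact: leq_ltn_trans ij jn.
Qed.

Lemma mulmx_tr_sum (R : pzRingType) n (w : 'rV[R]_n) :
  (w *m w^T) 0 0 = \sum_i w 0 i ^+ 2.
Proof. by rewrite mxE; apply: eq_bigr => i _; rewrite mxE expr2. Qed.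

Lemma mulmx_tr_eq0 (R : realDomainType) n (w : 'rV[R]_n) :
  ((w *m w^T) 0 0 == 0) = (w == 0).
Proof.
apply/eqP/eqP => [|->]; last by rewrite mul0mx mxE.
rewrite mulmx_tr_sum => /eqP; rewrite psumr_eq0 => [/allP h|i _]; last exact: sqr_ge0.
apply/rowP => i; rewrite mxE; apply/eqP.
by have := h i (mem_index_enum i); rewrite sqrf_eq0.
Qed.

Lemma mulmx_tr_gt0 (R : realDomainType) n (w : 'rV[R]_n) :
  w != 0 -> 0 < (w *m w^T) 0 0.
Proof.
move=> w0; rewrite lt_def mulmx_tr_eq0 w0 mulmx_tr_sum.
by apply: sumr_ge0 => i _; exact: sqr_ge0.
Qed.

(** If [e] and [u] differ, the reflection in the hyperplane orthogonal to [e - u] works, because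
    both vectors have unit length. *)
Lemma householder (R : realFieldType) n (e u : 'rV[R]_n) :
  e *m e^T = 1%:M -> u *m u^T = 1%:M ->
  exists H : 'M[R]_n, H^T *m H = 1%:M /\ e *m H = u.
Proof.
move=> ee uu; case: (eqVneq e u) => [->|neu].
  by exists 1%:M; rewrite trmx1 mul1mx mulmx1.
pose w := e - u; pose c := (w *m w^T) 0 0.
have c0 : c != 0 by rewrite mulmx_tr_eq0 subr_eq0.
have wwE : w *m w^T = c%:M by exact: mx11_scalar.
have ue : u *m e^T = e *m u^T.
  by rewrite [LHS]mx11_scalar [RHS]mx11_scalar; congr (_%:M);
     rewrite -[e *m u^T]trmxK trmx_mul trmxK [in RHS]mxE.
(* Unit length gives [w w^T = 2 - 2 e u^T = 2 e w^T], so the reflection subtracts exactly [w] from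
   [e]. *)
have ewE : e *m w^T = (c / 2)%:M.
  have : w *m w^T = 2 *: (e *m w^T).
    rewrite /w linearB /= mulmxBl !mulmxBr ee uu ue.
    by rewrite scaler_nat mulr2n opprB.
  rewrite wwE => cE; apply: (scalerI (a := 2)); first by rewrite pnatr_eq0.
  by rewrite -cE scale_scalar_mx mulrCA divff ?mulr1 // pnatr_eq0.
pose H := 1%:M - (2 / c) *: (w^T *m w).
have HT : H^T = H by rewrite /H linearB linearZ /= trmx1 trmx_mul trmxK.
exists H; split.
  have TT : (w^T *m w) *m (w^T *m w) = c *: (w^T *m w).
    by rewrite -mulmxA (mulmxA w) wwE mul_scalar_mx -scalemxAr.
  have aac : 2 / c * (2 / c) * c = 2 / c + 2 / c by field.
  rewrite HT /H; move: (w^T *m w) TT => T TT.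
  rewrite mulmxBl !mulmxBr !mulmx1 mul1mx.
  rewrite -scalemxAl -scalemxAr TT !scalerA aac scalerDl.
  by rewrite opprB addrK subrK.
rewrite mulmxBr mulmx1 -scalemxAr mulmxA ewE mul_scalar_mx scalerA.
rewrite mulrA divfK // divff ?pnatr_eq0 // scale1r /w.
by rewrite opprB addrC subrK.
Qed.

(** Deflation: a reflection taking the first basis vector to a unit eigenvector for [d 0] isolates
    [d 0] in a corner, and cancelling its linear factor leaves the induction hypothesis for the
    remaining symmetric block. This keeps the eigenvalues in the prescribed order. *)
Lemma orthogonal_diagonalization (R : rcfType) n (A : 'M[R]_n) (d : 'I_n -> R) :
  A^T = A -> char_poly A = \prod_i ('X - (d i)%:P) ->
  exists Q : 'M[R]_n, Q^T *m Q = 1%:M /\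
    A = Q *m diag_mx (\row_i d i) *m Q^T.
Proof.
elim: n A d => [|n IHn] A d Asym charA.
  by exists 1%:M; rewrite !flatmx0; split=> //; rewrite [A]flatmx0.
have : root (char_poly A) (d 0)
  by rewrite charA big_ord_recl rootM root_XsubC eqxx.
rewrite -eigenvalue_root_char => /eigenvalueP[v vA v0].
have := mulmx_tr_gt0 v0; have := mx11_scalar (v *m v^T).
move: (_ 0 0) => c vv c0.
pose u := (Num.sqrt c)^-1 *: v.
have uA : u *m A = d 0 *: u by rewrite -scalemxAl vA !scalerA mulrC.
have uu : u *m u^T = 1%:M.
  rewrite linearZ /= -scalemxAl -scalemxAr scalerA vv scale_scalar_mx.
  by rewrite -invfM -expr2 sqr_sqrtr ?ltW // mulVf // gt_eqF.
pose e : 'rV[R]_n.+1 := delta_mx 0 0.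
have ee : e *m e^T = 1%:M.
  by rewrite trmx_delta mul_delta_mx [LHS]mx11_scalar mxE.
have [H [HH eH]] := householder ee uu.
have HH' : H *m H^T = 1%:M by exact: mulmx1C.
pose B : 'M[R]_(1 + n) := H *m A *m H^T.
have Bsym : B^T = B by rewrite /B !trmx_mul trmxK Asym mulmxA.
have eB : e *m B = d 0 *: e.
  by rewrite /B !mulmxA eH uA -scalemxAl -eH -mulmxA HH' mulmx1.
have Brow j : B 0 j = (d 0) *+ (j == 0).
  by have /rowP/(_ j) := eB; rewrite -rowE !mxE mulr_natr => ->.
(* The eigenvector equation clears the first row, and symmetry clears the first column. *)
have BE : B = block_mx (d 0)%:M 0 0 (drsubmx B).
  rewrite -[LHS]submxK; congr block_mx; apply/matrixP => i j.
  - by rewrite !ord1 2!mxE lshift0 Brow mxE.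
  - by rewrite ord1 2!mxE lshift0 Brow mxE.
  - by rewrite ord1 2!mxE lshift0 -Bsym mxE Brow mxE.
have charB : char_poly B = ('X - (d 0)%:P) * char_poly (drsubmx B).
  rewrite {1}BE /char_poly /char_poly_mx (@map_block_mx _ _ _ 1 n 1 n) !map_mx0.
  rewrite (@scalar_mx_block _ 1 n) opp_block_mx add_block_mx !oppr0 !addr0.
  by rewrite det_ublock map_scalar_mx -(raddfB (@scalar_mx _ 1)) det_scalar1.
have charB' : char_poly (drsubmx B) = \prod_i ('X - (d (lift ord0 i))%:P).
  have d0 : 'X - (d 0)%:P != 0 by rewrite polyXsubC_eq0.
  by apply: (mulfI d0); rewrite -charB char_poly_conj // charA big_ord_recl.
have [||Q [QQ QE]] := IHn (drsubmx B) (fun i => d (lift ord0 i)).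
- by rewrite trmx_drsub Bsym.
- by [].
pose K : 'M[R]_(1 + n) := block_mx 1%:M 0 0 Q.
have KT : K^T = block_mx 1%:M 0 0 Q^T by rewrite tr_block_mx trmx1 !trmx0.
have KK : K^T *m K = 1%:M.
  rewrite KT mulmx_block !(mul0mx, mulmx0, mul1mx, addr0, add0r) QQ.
  by rewrite -scalar_mx_block.
pose D : 'M[R]_(1 + n) := diag_mx (\row_i d i).
have BK : B = K *m D *m K^T.
  rewrite /D.
  have -> : \row_i d i = row_mx (d 0)%:M (\row_i d (lift ord0 i)) :> 'rV_(1 + n).
    apply/rowP => i; case: (@split_ordP 1 n i) => j ->.
      by rewrite row_mxEl !mxE ord1 lshift0.
    by rewrite row_mxEr !mxE rshift1.
  have -> : diag_mx (row_mx (d 0)%:M (\row_i d (lift ord0 i))) =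
      block_mx (d 0)%:M 0 0 (diag_mx (\row_i d (lift ord0 i))).
    rewrite diag_mx_row; congr block_mx.
    by apply/matrixP => i j; rewrite !ord1 !mxE.
  rewrite KT (@mulmx_block _ 1 n 1 n 1 n) (@mulmx_block _ 1 n 1 n 1 n).
  rewrite !(mul0mx, mulmx0, mul1mx, mulmx1, addr0, add0r).
  by rewrite -QE -BE.
exists (H^T *m K); split.
  by rewrite trmx_mul trmxK mulmxA -(mulmxA K^T) HH' mulmx1.
have -> : A = H^T *m B *m H by rewrite /B !mulmxA HH mul1mx -(mulmxA A) HH mulmx1.
by rewrite BK trmx_mul trmxK !mulmxA.
Qed.

(** * Weighted Ky Fan inequality *)

(** For [l.+1] orthonormal vectors, [C i] stands for the squared length of the projection of the
    [i]-th eigenvector onto their span. *)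
Lemma ky_fan (R : realDomainType) m l (g : nat -> R) (C : 'I_m -> R) :
  (l < m)%N -> (forall i j, (i <= j < m)%N -> g j <= g i) ->
  (forall i, 0 <= C i <= 1) -> \sum_i C i = l.+1%:R ->
  0 <= \sum_(k < l.+1) g k - \sum_i C i * g i /\
  (\sum_(k < l.+1) g k - \sum_i C i * g i = 0 ->
   forall i : 'I_m, g i < g l -> C i = 0).
Proof.
move=> lm g_anti C01 sumC.
(* The indicator and [C] have equal mass, so subtracting [g l] changes nothing in total; both
   factors are then nonnegative up to [l] and nonpositive beyond. *)
pose t (i : 'I_m) := ((i < l.+1)%N%:R - C i) * (g i - g l).
have head (h : nat -> R) : \sum_(k < l.+1) h k = \sum_(i < m) (i < l.+1)%N%:R * h i.
  rewrite (big_ord_widen _ h lm) big_mkcond /=; apply: eq_bigr => i _.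
  by case: ifP; rewrite ?mul1r ?mul0r.
have -> : \sum_(k < l.+1) g k - \sum_i C i * g i = \sum_i t i.
  transitivity (\sum_i t i + g l * (\sum_(i < m) (i < l.+1)%N%:R - \sum_i C i)).
    rewrite head -!sumrB mulr_sumr -big_split /=; apply: eq_bigr => i _.
    by rewrite /t; ring.
  have := head (fun=> 1); rewrite sumr_const card_ord.
  under [in RHS]eq_bigr => i _ do rewrite mulr1.
  by move=> <-; rewrite sumC subrr mulr0 addr0.
have t_ge0 i : 0 <= t i.
  have /andP[C0 C1] := C01 i; rewrite /t.
  case: (ltnP i l.+1) => il.
    by rewrite mulr_ge0 // subr_ge0 // g_anti // -ltnS il.
  rewrite mulr_le0 ?sub0r ?oppr_le0 // subr_le0 g_anti // ltn_ord andbT.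
  exact: ltnW.
split=> [|/eqP]; first exact: sumr_ge0.
rewrite psumr_eq0 // => /allP t0 i gil.
have /eqP := t0 i (mem_index_enum i); rewrite /t.
case: (ltnP i l.+1) => il.
  by move: gil; rewrite ltNge g_anti // -ltnS il.
move/eqP; rewrite sub0r mulf_eq0 oppr_eq0 subr_eq0 (lt_eqF gil) orbF.
by move/eqP.
Qed.

(* Induction on [q], peeling off the constant weight [a q]: the remaining
   weights [a k - a q] only involve the first [q] columns. *)
Lemma weighted_ky_fan (R : realDomainType) m q (g a : nat -> R)
    (c : 'I_m -> 'I_q -> R) :
  (q <= m)%N -> (forall i j, (i <= j < m)%N -> g j <= g i) ->
  (forall k l, (k <= l < q)%N -> a l <= a k) ->
  (forall k, (k < q)%N -> 0 <= a k) -> (forall i k, 0 <= c i k) ->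
  (forall k, \sum_i c i k = 1) -> (forall i, \sum_k c i k <= 1) ->
  let gap := \sum_(k < q) a k * (g k - \sum_i c i k * g i) in
  0 <= gap /\
  ((forall k l, (k < q)%N -> (l < q)%N -> g l < g k -> a l < a k) -> gap = 0 ->
   forall (k : 'I_q) (i : 'I_m), 0 < a k -> g i < g k -> c i k = 0).
Proof.
elim: q a c => [|q IHq] a c qm g_anti a_anti a_ge0 c_ge0 col1 row1 gap.
  by split=> [|_ _ []//]; rewrite /gap big_ord0.
pose w := widen_ord (leqnSn q).
pose D k := g (nat_of_ord k) - \sum_i c i k * g i.
pose gap1 := \sum_(k < q) (a k - a q) * D (w k).
pose gap2 := \sum_(k < q.+1) g k - \sum_i (\sum_k c i k) * g i.
have gapE : gap = gap1 + a q * gap2.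
  have -> : gap2 = \sum_k D k.
    rewrite /gap2 /D sumrB; congr (_ - _).
    by rewrite exchange_big; apply: eq_bigr => i _; rewrite mulr_suml.
  transitivity (\sum_(k < q.+1) (a k - a q) * D k + a q * \sum_k D k).
    rewrite mulr_sumr -big_split; apply: eq_bigr => k _ /=.
    by rewrite -mulrDl subrK.
  by rewrite big_ord_recr /= subrr mul0r addr0.
have [gap2_ge0 gap2_eq0] : 0 <= gap2 /\
    (gap2 = 0 -> forall i : 'I_m, g i < g q -> \sum_k c i k = 0).
  apply: ky_fan => // [i|].
    by rewrite row1 andbT sumr_ge0.
  by rewrite exchange_big; under eq_bigr do rewrite col1; rewrite sumr_const card_ord.
have [||||i|gap1_ge0 gap1_eq0] := IHq (fun k => a k - a q)
    (fun i k => c i (w k)) (ltnW qm) g_anti.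
- by move=> k l /andP[kl lq]; rewrite lerB // a_anti // kl ltnW.
- by move=> k kq; rewrite subr_ge0 a_anti // ltnW //= ltnS.
- by [].
- by [].
- by apply: le_trans (row1 i); rewrite [leRHS]big_ord_recr /= lerDl.
have aq_ge0 : 0 <= a q by apply: a_ge0.
split=> [|a_strict gap0 k i ak gik].
  by rewrite gapE addr_ge0 // mulr_ge0.
have [gap10 agap20] : gap1 = 0 /\ a q * gap2 = 0.
  have : gap1 + a q * gap2 = 0 by rewrite -gapE.
  by move/eqP; rewrite paddr_eq0 ?mulr_ge0 // => /andP[/eqP-> /eqP->].
have gap1_case (j : 'I_q) : 0 < a j - a q -> g i < g j -> c i (w j) = 0.
  apply: gap1_eq0 => // k' l' k'q l'q glk; rewrite ltrD2r.
  by apply: a_strict => //; apply: ltnW.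
have row_case : 0 < a q -> g i < g q -> c i k = 0.
  move=> aq giq; move/eqP: agap20; rewrite mulf_eq0 gt_eqF //= => /eqP gap20.
  have /eqP := gap2_eq0 gap20 i giq.
  by rewrite psumr_eq0 // => /allP/(_ k (mem_index_enum k))/eqP.
have kq : (k <= q)%N by rewrite -ltnS.
have kE (kltq : (k < q)%N) : k = w (Ordinal kltq) by apply: val_inj.
have gqk : g q <= g k by rewrite g_anti // kq.
(* If [a q] is zero, the excess weight of [k] is still positive and the induction applies. Otherwise
   a tie [g k = g q] is settled by the row sums, while [g q < g k] makes the excess weight positive
   through [a_strict]. *)
have [aq0|aq_gt0] := leP (a q) 0.
  have kltq : (k < q)%N.
    rewrite ltn_neqAle kq andbT; apply: contraTneq ak => ->.
    by rewrite -leNgt.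
  rewrite (kE kltq); apply: gap1_case => //.
  by rewrite subr_gt0 (le_lt_trans aq0).
have [gqk_lt|gkq] := ltP (g q) (g k); last first.
  by apply: row_case => //; apply: lt_le_trans gkq.
have kltq : (k < q)%N.
  by rewrite ltn_neqAle kq andbT; apply: contraTneq gqk_lt => ->; rewrite ltxx.
rewrite (kE kltq); apply: gap1_case => //.
by rewrite subr_gt0 a_strict.
Qed.

(** * Singular values and the trace gap *)

Lemma mul_tr_diagE (R : comPzRingType) m n (B : 'M[R]_(m, n)) k :
  (B^T *m B) k k = \sum_i B i k ^+ 2.
Proof. by rewrite mxE; apply: eq_bigr => i _; rewrite mxE expr2. Qed.

(** In an orthonormal eigenbasis of the Gram matrix, the columns of [A] are orthogonal with squared
    lengths [a k]. Full column rank makes these positive, so normalizing the columns gives [W]; the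
    right factor is the transposed eigenbasis. *)
Lemma singular_value_decomposition (R : rcfType) m q (A : 'M[R]_(m, q)) :
  \rank A = q -> exists (W : 'M[R]_(m, q)) (a : nat -> R) (P : 'M[R]_q),
    [/\ W^T *m W = 1%:M, P^T *m P = 1%:M, forall k, (k < q)%N -> 0 < a k,
        forall k l, (k <= l < q)%N -> a l <= a k &
        A = W *m diag_mx (\row_(k < q) Num.sqrt (a k)) *m P].
Proof.
move=> rankA.
have AAsym : (A^T *m A)^T = A^T *m A by rewrite trmx_mul trmxK.
have [a [charAA a_anti]] := symmetric_char_poly_sorted AAsym.
have [P [PP AAE]] := orthogonal_diagonalization AAsym charAA.
have PP' : P *m P^T = 1%:M by exact: mulmx1C.
pose B := A *m P.
have BB : B^T *m B = diag_mx (\row_(k < q) a k).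
  rewrite /B trmx_mul !mulmxA -(mulmxA P^T) AAE.
  by rewrite !mulmxA PP mul1mx -mulmxA PP mulmx1.
have a_gt0 k : (k < q)%N -> 0 < a k.
  move=> kq; pose k' := Ordinal kq.
  have aE : a k = \sum_i B i k' ^+ 2 by rewrite -mul_tr_diagE BB !mxE eqxx.
  rewrite aE lt_def sumr_ge0 ?andbT => [|i _]; last exact: sqr_ge0.
  apply/negP; rewrite psumr_eq0 => [/allP B0|i _]; last exact: sqr_ge0.
  (* A vanishing [a k] would make a column of [B] zero, against its full column rank. *)
  have colB0 : B *m delta_mx k' 0 = 0 :> 'cV_m.
    rewrite -colE; apply/colP => i; rewrite mxE [RHS]mxE.
    by have := B0 i (mem_index_enum i); rewrite sqrf_eq0 => /eqP.
  have freeB : row_free B^T.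
    rewrite /row_free mxrank_tr /B mxrankMfree ?rankA //.
    by rewrite row_free_unit; case/mulmx1_unit: PP'.
  have /(congr1 trmx) := colB0; rewrite trmx_mul trmx0 trmx_delta => /eqP.
  rewrite mulmx_free_eq0 // => /eqP/matrixP/(_ 0 k').
  by rewrite !mxE !eqxx => /eqP; rewrite oner_eq0.
have AB : A = B *m P^T by rewrite /B -mulmxA PP' mulmx1.
clearbody B.
pose r : 'rV[R]_q := \row_k Num.sqrt (a k).
pose r' : 'rV[R]_q := \row_k (Num.sqrt (a k))^-1.
have sqrt_gt0 (k : 'I_q) : 0 < Num.sqrt (a k) by rewrite sqrtr_gt0 a_gt0.
have r'r : diag_mx r' *m diag_mx r = 1%:M.
  rewrite mulmx_diag; apply/matrixP => i j; rewrite !mxE mulVf //.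
  by rewrite gt_eqF.
exists (B *m diag_mx r'), a, P^T; split=> //.
- rewrite trmx_mul tr_diag_mx !mulmxA -(mulmxA _ _ B) BB !mulmx_diag.
  apply/matrixP => i j; rewrite !mxE.
  case: eqP => [->|]; rewrite ?mulr0n // !mulr1n.
  rewrite -[X in _ * X * _]sqr_sqrtr ?ltW ?a_gt0 //.
  by field; rewrite gt_eqF.
- by rewrite trmxK.
- by rewrite -(mulmxA B) r'r mulmx1.
Qed.

(** Bessel's inequality: a diagonal entry of the projection [Z *m Z^T] is the squared length of its
    column, hence at least its own square. *)
Lemma mul_mx_tr_diag_le1 (R : realDomainType) m n (Z : 'M[R]_(m, n)) i :
  Z^T *m Z = 1%:M -> \sum_k Z i k ^+ 2 <= 1.
Proof.
move=> ZZ; pose P := Z *m Z^T.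
have PiE : P i i = \sum_k Z i k ^+ 2.
  by rewrite mxE; apply: eq_bigr => k _; rewrite mxE expr2.
have PP : P^T *m P = P.
  by rewrite /P trmx_mul trmxK mulmxA -(mulmxA Z) ZZ mulmx1.
have P2 : P i i = \sum_j P j i ^+ 2 by rewrite -mul_tr_diagE PP.
have : P i i ^+ 2 <= P i i.
  rewrite {2}P2 (bigD1 i) //= lerDl sumr_ge0 // => j _; exact: sqr_ge0.
rewrite -PiE; have : 0 <= P i i by rewrite PiE sumr_ge0 // => k _; exact: sqr_ge0.
by nra.
Qed.

(** The squared coordinates of the columns of [W] in an eigenbasis of [S] have column sums 1 and row
    sums at most 1, as the weighted Ky Fan inequality requires. Equality is treated in two rounds:
    Ky Fan excludes coordinates with eigenvalue below [g k], then the vanishing gap excludes those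
    above. *)
Lemma trace_gap (R : rcfType) m q (S : 'M[R]_m) (g a : nat -> R)
    (W : 'M[R]_(m, q)) :
  (q <= m)%N -> S^T = S -> char_poly S = \prod_(i < m) ('X - (g i)%:P) ->
  (forall i j, (i <= j < m)%N -> g j <= g i) ->
  (forall k l, (k <= l < q)%N -> a l <= a k) ->
  (forall k, (k < q)%N -> 0 < a k) -> W^T *m W = 1%:M ->
  let gap := \sum_(k < q) a k * (g k - (W^T *m S *m W) k k) in
  0 <= gap /\
  ((forall k l, (k < q)%N -> (l < q)%N -> g l < g k -> a l < a k) -> gap = 0 ->
   S *m W = W *m diag_mx (\row_k g k)).
Proof.
move=> qm Ssym charS g_anti a_anti a_gt0 WW gap.
have [Q [QQ SE]] := orthogonal_diagonalization Ssym charS.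
have QQ' : Q *m Q^T = 1%:M by exact: mulmx1C.
pose Z := Q^T *m W; pose c (i : 'I_m) (k : 'I_q) := Z i k ^+ 2.
have ZZ : Z^T *m Z = 1%:M.
  by rewrite trmx_mul trmxK mulmxA -(mulmxA _ Q) QQ' mulmx1.
have WE : W = Q *m Z by rewrite /Z mulmxA QQ' mul1mx.
have sZE : W^T *m S *m W = Z^T *m (diag_mx (\row_i g i) *m Z).
  by rewrite SE /Z trmx_mul trmxK !mulmxA.
clearbody Z.
have sE k : (W^T *m S *m W) k k = \sum_i c i k * g i.
  rewrite sZE mxE; apply: eq_bigr => i _.
  by rewrite mul_diag_mx !mxE /c expr2 mulrCA mulrC.
have gapE : gap = \sum_(k < q) a k * (g k - \sum_i c i k * g i).
  by apply: eq_bigr => k _; rewrite sE.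
have c_ge0 i k : 0 <= c i k by exact: sqr_ge0.
have col1 k : \sum_i c i k = 1 by rewrite -mul_tr_diagE ZZ mxE eqxx.
have row1 i : \sum_k c i k <= 1 by exact: mul_mx_tr_diag_le1.
have a_ge0 k : (k < q)%N -> 0 <= a k by move=> kq; rewrite ltW // a_gt0.
have [gap_ge0 gap_eq0] := weighted_ky_fan qm g_anti a_anti a_ge0 c_ge0 col1 row1.
rewrite -gapE in gap_ge0 gap_eq0; split=> // a_strict gap0.
have c0 (k : 'I_q) (i : 'I_m) : g i < g k -> c i k = 0.
  by apply: gap_eq0 => //; apply: a_gt0.
have cg_ge0 k i : 0 <= c i k * (g i - g k).
  have [/c0->|?] := ltP (g i) (g k); first by rewrite mul0r.
  by rewrite mulr_ge0 // subr_ge0.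
have sgE k : (W^T *m S *m W) k k - g k = \sum_i c i k * (g i - g k).
  rewrite sE; under [RHS]eq_bigr do rewrite mulrBr.
  by rewrite sumrB -mulr_suml col1 mul1r.
have cg0 k i : c i k * (g i - g k) = 0.
  have : \sum_(k < q) a k * ((W^T *m S *m W) k k - g k) = 0.
    apply/eqP; rewrite -oppr_eq0 -sumrN -[X in _ == X]gap0; apply/eqP.
    by apply: eq_bigr => j _; rewrite -mulrN opprB.
  move/eqP; rewrite psumr_eq0 => [/allP/(_ k (mem_index_enum k))|j _]; last first.
    by rewrite sgE mulr_ge0 ?sumr_ge0 ?ltW ?a_gt0.
  rewrite mulf_eq0 gt_eqF ?a_gt0 //= sgE psumr_eq0 //.
  by move/allP/(_ i (mem_index_enum i))/eqP.
(* Column [k] of [Z] is now supported on the rows [i] with [g i = g k]. *)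
have DZ : diag_mx (\row_i g i) *m Z = Z *m diag_mx (\row_k g k).
  apply/matrixP => i k; rewrite mul_diag_mx mul_mx_diag !mxE.
  have /eqP := cg0 k i; rewrite mulf_eq0 sqrf_eq0 subr_eq0 => /orP[/eqP Z0|/eqP->].
    by rewrite Z0 mulr0 mul0r.
  by rewrite mulrC.
by rewrite SE [in LHS]WE [in RHS]WE -!mulmxA (mulmxA Q^T) QQ mul1mx DZ.
Qed.

(** * The objectives along a singular value decomposition *)

(** Sylvester's determinant identity: the block matrix [K] becomes lower triangular both by a left
    and by a right unipotent factor. *)
Lemma det_scalar_addM (F : fieldType) m q (d : F)
    (B : 'M[F]_(m, q)) (C : 'M[F]_(q, m)) :
  d != 0 -> \det (B *m C + d%:M) = d ^+ m * \det (1%:M + d^-1 *: (C *m B)).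
Proof.
move=> d0; pose K := block_mx d%:M (- B) C 1%:M.
have KL : block_mx 1%:M B 0 1%:M *m K = block_mx (B *m C + d%:M) 0 C 1%:M.
  rewrite mulmx_block !(mul1mx, mul0mx, mulmx1, add0r).
  by rewrite addNr addrC.
have KR : K *m block_mx 1%:M (d^-1 *: B) 0 1%:M =
    block_mx d%:M 0 C (1%:M + d^-1 *: (C *m B)).
  rewrite mulmx_block !(mul1mx, mulmx0, mulmx1, addr0) mul_scalar_mx scalerA.
  by rewrite divff // scale1r subrr -scalemxAr addrC.
have := congr1 determinant KL.
rewrite det_mulmx det_ublock det_lblock !det1 !mul1r mulr1 => <-.
have := congr1 determinant KR.
rewrite det_mulmx det_ublock det_lblock !det1 !mulr1 => ->.
by rewrite det_scalar.
Qed.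

Lemma mxtrace_conj_diag (R : comPzRingType) m q (S : 'M[R]_m) (W : 'M[R]_(m, q))
    (a : 'rV[R]_q) :
  \tr (S *m (W *m diag_mx a *m W^T)) = \sum_k a 0 k * (W^T *m S *m W) k k.
Proof.
rewrite mulmxA mxtrace_mulC !mulmxA /mxtrace; apply: eq_bigr => k _.
by rewrite mul_mx_diag !mxE mulrC.
Qed.

Lemma ln_prod (R : realType) n (f : 'I_n -> R) :
  (forall i, 0 < f i) -> ln (\prod_i f i) = \sum_i ln (f i).
Proof.
move=> f_gt0.
(* [lnM] needs positive arguments, so the induction also carries positivity of the partial
   products. *)
suff [] : 0 < \prod_i f i /\ ln (\prod_i f i) = \sum_i ln (f i) by [].
elim/big_rec2: _ => [|i y x _ [x_gt0 <-]]; first by rewrite ln1.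
by rewrite mulr_gt0 // lnM // posrE.
Qed.

Section Expansions.
Variables (R : realType) (m q : nat) (S : 'M[R]_m) (W : 'M[R]_(m, q)).
Variables (a : nat -> R) (P : 'M[R]_q) (delta : R).
Hypotheses (WW : W^T *m W = 1%:M) (PP : P^T *m P = 1%:M).
Hypothesis a_ge0 : forall k, (k < q)%N -> 0 <= a k.
Let A := W *m diag_mx (\row_(k < q) Num.sqrt (a k)) *m P.
Let s (k : 'I_q) := (W^T *m S *m W) k k.

Lemma svd_gram : A *m A^T = W *m diag_mx (\row_(k < q) a k) *m W^T.
Proof.
have PP' : P *m P^T = 1%:M by exact: mulmx1C.
rewrite /A !trmx_mul tr_diag_mx !mulmxA -[_ *m P *m _]mulmxA PP' mulmx1.
rewrite -(mulmxA W) mulmx_diag; congr (_ *m diag_mx _ *m _).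
by apply/rowP => k; rewrite !mxE -expr2 sqr_sqrtr ?a_ge0.
Qed.

Lemma objF_svd : objF S (A, delta) = \tr (S *m S) +
  \sum_(k < q) (a k ^+ 2 - 2 * a k * s k + 2 * delta * a k) -
  2 * delta * \tr S + m%:R * delta ^+ 2.
Proof.
rewrite /objF /= svd_gram; set T := W *m _ *m _.
have trST : \tr (S *m T) = \sum_(k < q) a k * s k.
  by rewrite mxtrace_conj_diag; apply: eq_bigr => k _; rewrite mxE.
have trT : \tr T = \sum_(k < q) a k.
  rewrite -[T]mul1mx mxtrace_conj_diag mulmx1 WW; apply: eq_bigr => k _.
  by rewrite !mxE eqxx mulr1.
have trTT : \tr (T *m T) = \sum_(k < q) a k ^+ 2.
  rewrite mxtrace_conj_diag; apply: eq_bigr => k _.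
  rewrite /T !mulmxA WW mul1mx -mulmxA WW mulmx1.
  by rewrite !mxE eqxx expr2.
rewrite -[_ ^+ 2]/(_ *m _) !mulmxBl !mulmxBr !mul_scalar_mx !mul_mx_scalar.
rewrite !linearB /= !linearZ /= mxtrace_scalar (mxtrace_mulC T S) trST trTT trT.
rewrite !big_split /= sumrN.
have -> : \sum_(k < q) 2 * a k * s k = 2 * \sum_(k < q) a k * s k.
  by rewrite mulr_sumr; apply: eq_bigr => k _; rewrite mulrA.
rewrite -mulr_sumr; have scE (x y : R^o) : x *: y = x * y by [].
by rewrite !scE; ring.
Qed.

Lemma objG_svd : 0 < delta -> objG S (A, delta) =
  m%:R * ln delta + \sum_(k < q) ln (1 + a k / delta) + \tr S / delta -
  \sum_(k < q) (delta^-1 - (a k + delta)^-1) * s k.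
Proof.
move=> d_gt0; have d0 : delta != 0 by rewrite gt_eqF.
have ad0 (k : 'I_q) : a k + delta != 0 by rewrite gt_eqF // ltr_wpDl // a_ge0.
have ad_gt0 (k : 'I_q) : 0 < 1 + a k / delta.
  by rewrite ltr_pwDl // divr_ge0 ?a_ge0 // ltW.
rewrite /objG /= svd_gram.
(* Woodbury's formula: along column [k] of [W] the inverse has eigenvalue [1 / (a k + delta)]
   instead of [1 / delta], and [w] records the drop. *)
pose w : 'rV[R]_q := \row_k (delta^-1 - (a k + delta)^-1).
have -> : invmx (W *m diag_mx (\row_(k < q) a k) *m W^T + delta%:M) =
    delta^-1%:M - W *m diag_mx w *m W^T.
  set T := W *m _ *m _; set T' := W *m _ *m _.
  have TT' : T *m T' = W *m diag_mx (\row_(k < q) (a k * w 0 k)) *m W^T.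
    rewrite /T /T' !mulmxA -(mulmxA _ W^T W) WW mulmx1 -(mulmxA W).
    rewrite mulmx_diag; congr (_ *m diag_mx _ *m _).
    by apply/rowP => k; rewrite !mxE.
  have TT'Z : T *m T' + delta *: T' = delta^-1 *: T.
    have conjZ (c : R) v :
        c *: (W *m diag_mx v *m W^T) = W *m diag_mx (c *: v) *m W^T.
      by rewrite linearZ -scalemxAr -scalemxAl.
    rewrite TT' /T /T' !conjZ -mulmxDl -mulmxDr -linearD /=.
    congr (_ *m diag_mx _ *m _); apply/rowP => k; rewrite !mxE; field.
    by rewrite d0 ad0.
  have inv : (T + delta%:M) *m (delta^-1%:M - T') = 1%:M.
    rewrite mulmxBr !mulmxDl -scalar_mxM mul_mx_scalar (mul_scalar_mx _ T') TT'Z.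
    by rewrite divff // addrAC subrr add0r.
  have [unitT _] := mulmx1_unit inv.
  by rewrite -[LHS]mulmx1 -inv mulKmx.
(* Sylvester's identity leaves a diagonal determinant of size [q]. *)
have -> : \det (W *m diag_mx (\row_(k < q) a k) *m W^T + delta%:M) =
    delta ^+ m * \prod_(k < q) (1 + a k / delta).
  rewrite det_scalar_addM // mulmxA WW mul1mx -diag_const_mx -linearZ -linearD /=.
  rewrite det_diag; congr (_ * _); apply: eq_bigr => k _.
  by rewrite !mxE mulrC.
rewrite lnM ?posrE ?exprn_gt0 ?prodr_gt0 // lnXn // ln_prod //.
rewrite mulmxBl mul_scalar_mx linearB /= linearZ /= mxtrace_mulC mxtrace_conj_diag.
under [X in _ - X]eq_bigr do rewrite mxE.
by rewrite !addrA mulr_natl; congr (_ + _ - _); rewrite mulrC.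
Qed.

End Expansions.

(** * Excess of the objectives over their minimal values *)

Section Gaps.
Variables (R : realType) (m q : nat) (S : 'M[R]_m) (W : 'M[R]_(m, q)).
Variables (a g : nat -> R) (P : 'M[R]_q) (delta dh : R).
Hypotheses (WW : W^T *m W = 1%:M) (PP : P^T *m P = 1%:M).
Hypothesis a_ge0 : forall k, (k < q)%N -> 0 <= a k.
Hypothesis trS : \tr S = \sum_(k < q) g k + (m%:R - q%:R) * dh.
Let A := W *m diag_mx (\row_(k < q) Num.sqrt (a k)) *m P.
Let s (k : 'I_q) := (W^T *m S *m W) k k.

(** When [g] lists the eigenvalues and [dh] is the mean of the discarded ones, this is the sum of
    their squared deviations from [dh]. *)
Definition minF : R :=
  \tr (S *m S) - \sum_(k < q) g k ^+ 2 - (m%:R - q%:R) * dh ^+ 2.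

(** Completing squares; [trS] turns the terms linear in [delta] into a square around [dh]. *)
Lemma objF_gap : objF S (A, delta) = minF +
  (\sum_(k < q) (a k + delta - g k) ^+ 2 + (m%:R - q%:R) * (delta - dh) ^+ 2 +
   2 * \sum_(k < q) a k * (g k - s k)).
Proof.
rewrite objF_svd // -/s /minF trS.
have -> : \sum_(k < q) (a k ^+ 2 - 2 * a k * s k + 2 * delta * a k) =
    \sum_(k < q) (a k + delta - g k) ^+ 2 + 2 * (\sum_(k < q) a k * (g k - s k)) -
    \sum_(k < q) g k ^+ 2 + 2 * delta * \sum_(k < q) g k - \sum_(k < q) delta ^+ 2.
  rewrite !mulr_sumr -big_split -sumrB -big_split -sumrB /=.
  by apply: eq_bigr => k _; ring.
by rewrite sumr_const card_ord -mulr_natl; ring.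
Qed.

(** A scalar Stein loss: at [x = g / sigma] it is the excess of [ln sigma + g / sigma] over its
    minimum [ln g + 1]. *)
Definition gap_ln (x : R) : R := x - 1 - ln x.

Lemma gap_ln_ge0 x : 0 < x -> 0 <= gap_ln x.
Proof.
move=> x_gt0; have := expR_ge1Dx (ln x); rewrite lnK ?posrE // /gap_ln; lra.
Qed.

Lemma gap_ln_eq0 x : 0 < x -> gap_ln x = 0 -> x = 1.
Proof.
move=> x_gt0; rewrite /gap_ln => x0; apply/eqP; rewrite -ln_eq0 //.
apply: contraT => /expR_gt1Dx; rewrite lnK ?posrE //; lra.
Qed.

(** The log-determinant of a covariance with eigenvalues [g k] and [m - q] copies of [dh], plus
    [m]. *)
Definition minG : R :=
  \sum_(k < q) (ln (g k) + 1) + (m%:R - q%:R) * (ln dh + 1).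

Lemma objG_gap : 0 < delta -> 0 < dh -> (forall k, (k < q)%N -> 0 < g k) ->
  objG S (A, delta) = minG +
  (\sum_(k < q) gap_ln (g k / (a k + delta)) +
   (m%:R - q%:R) * gap_ln (dh / delta) +
   \sum_(k < q) (delta^-1 - (a k + delta)^-1) * (g k - s k)).
Proof.
move=> d_gt0 dh_gt0 g_gt0.
have ad_gt0 (k : 'I_q) : 0 < a k + delta by rewrite ltr_wpDl // a_ge0.
rewrite objG_svd // -/s /minG trS.
have -> : \sum_(k < q) ln (1 + a k / delta) =
    \sum_(k < q) ln (a k + delta) - q%:R * ln delta.
  rewrite mulr_natl -[q in _ *+ q]card_ord -sumr_const -sumrB.
  apply: eq_bigr => k _; rewrite -ln_div ?posrE //; congr ln.
  by field; rewrite gt_eqF.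
have gap_div x y : 0 < x -> 0 < y -> gap_ln (x / y) = x / y - 1 - ln x + ln y.
  by move=> x0 y0; rewrite /gap_ln ln_div ?posrE //; ring.
(* The identity wanted for each column, solved for the logarithm so that it can be substituted. *)
have -> : \sum_(k < q) ln (a k + delta) =
    \sum_(k < q) gap_ln (g k / (a k + delta)) +
    \sum_(k < q) (ln (g k) + 1) +
    \sum_(k < q) (delta^-1 - (a k + delta)^-1) * (g k - s k) +
    \sum_(k < q) (delta^-1 - (a k + delta)^-1) * s k - delta^-1 * \sum_(k < q) g k.
  rewrite mulr_sumr -!big_split -sumrB /=; apply: eq_bigr => k _.
  by rewrite gap_div ?g_gt0 //; ring.
by rewrite gap_div //; ring.
Qed.

End Gaps.

(** The whole space serves as the neighbourhood. *)
Lemma strict_local_min_of_global (R : realType) (T : topologicalType)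
    (D E : set T) (f : T -> R) (x : T) (c : R) :
  D x -> E x -> (forall y, E y -> f y = c) ->
  (forall y, D y -> c <= f y /\ (f y = c -> E y)) ->
  strict_local_min_modulo D E f x.
Proof.
move=> Dx Ex fE fD; split=> //; apply: nearW => y /fD[cf fcE].
rewrite (fE x) //; split=> [/fE//|nEy].
by rewrite lt_neqAle cf andbT; apply: contra_notN nEy => /eqP/esym.
Qed.

Lemma centering_tr_mul (R : realType) m (b : 'cV[R]_m) :
  (forall i, 0 <= b i 0) -> (centering b)^T *m b = 0.
Proof.
move=> b_ge0; rewrite /centering; case: eqVneq => [->|b0]; first by rewrite mulmx0.
set one : 'cV[R]_m := const_mx 1; set t := (one^T *m b) 0 0.
have tE : one^T *m b = t%:M by exact: mx11_scalar.
(* Nonnegative entries with zero sum would force [b = 0]. *)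
have t0 : t != 0.
  have -> : t = \sum_i b i 0.
    by rewrite /t mxE; apply: eq_bigr => i _; rewrite !mxE mul1r.
  apply: contraNneq b0 => /eqP; rewrite psumr_eq0 // => /allP sum0.
  apply/eqP/colP => i; rewrite mxE.
  by apply/eqP; have := sum0 i (mem_index_enum i).
rewrite linearB linearZ /= trmx1 trmx_mul trmxK mulmxBl mul1mx -scalemxAl.
by rewrite -mulmxA tE mul_mx_scalar scalerA mulVf // scale1r subrr.
Qed.

(** Puts the candidate in the shape required by the gap formulas; off the diagonal the entrywise
    root is harmless, as the root of 0 is 0. *)
Lemma Ahat_svd (R : realType) m q (gamma : nat -> R) (U : 'M[R]_(m, q)) V :
  Ahat gamma U V = U *m diag_mx (\row_(k < q)
    Num.sqrt (gamma k.+1 - deltahat m q gamma)) *m V.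
Proof.
rewrite /Ahat; congr (_ *m _ *m _); apply/matrixP => i j; rewrite !mxE.
by case: eqP => [->|_]; rewrite ?mulr0n ?subr0 ?sqrtr0 // !mulr1n.
Qed.

(** * Optimality *)

Section Optimality.
Variables (R : realType) (m q : nat) (S : 'M[R]_m) (gamma : nat -> R).
Hypotheses (qm : (q < m)%N) (Ssym : S^T = S).
Hypothesis S_psd : forall x : 'cV[R]_m, 0 <= (x^T *m S *m x) 0 0.
Hypothesis S_gamma : ordered_eigenvalues S gamma.
Let g k := gamma k.+1.
Let dh := deltahat m q gamma.

Lemma char_poly_gamma : char_poly S = \prod_(i < m) ('X - (g i)%:P).
Proof. by case: S_gamma => -> _; rewrite big_add1 big_mkord. Qed.

Lemma gamma_anti i j : (i <= j < m)%N -> g j <= g i.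
Proof. by case: S_gamma => _ + /andP[ij jm]; apply. Qed.

Lemma mq_gt0 : 0 < m%:R - q%:R :> R.
Proof. by rewrite subr_gt0 ltr_nat. Qed.

Lemma deltahatE : (m%:R - q%:R) * dh = \sum_(q <= i < m) g i.
Proof.
rewrite /dh /deltahat big_add1 /= natrB ?(ltnW qm) // mulrA mulfV ?mul1r //.
by rewrite gt_eqF // mq_gt0.
Qed.

Lemma mxtrace_gamma : \tr S = \sum_(k < q) g k + (m%:R - q%:R) * dh.
Proof.
have [Q [QQ SE]] := orthogonal_diagonalization Ssym char_poly_gamma.
have -> : \tr S = \sum_(0 <= i < m) g i.
  rewrite SE mxtrace_mulC mulmxA QQ mul1mx mxtrace_diag big_mkord.
  by apply: eq_bigr => i _; rewrite mxE.
rewrite (big_cat_nat (n := q)) ?(ltnW qm) //= deltahatE.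
by rewrite big_mkord.
Qed.

Lemma gamma_ge0 i : (i < m)%N -> 0 <= g i.
Proof.
move=> im; have [Q [QQ SE]] := orthogonal_diagonalization Ssym char_poly_gamma.
(* The quadratic form is tested on the [i]-th eigenvector. *)
have := S_psd (Q *m delta_mx (Ordinal im) 0).
rewrite SE trmx_mul !mulmxA -(mulmxA _ Q^T) QQ mulmx1 -!(mulmxA _ Q^T) QQ mulmx1.
by rewrite trmx_delta -rowE -colE !mxE eqxx.
Qed.

Hypothesis gap : exists j : nat,
  [/\ (q < j <= m)%N, gamma j < gamma q & 0 < gamma j].
Hypothesis q_gt0 : (0 < q)%N.

Lemma deltahat_gt0 : 0 < dh.
Proof.
(* Index 0 is excluded by [q < j], and [gamma j.+1] is [g j]. *)
case: gap => -[|j] [/andP[qj jm] _ gj_gt0] //.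
rewrite -(pmulr_rgt0 _ mq_gt0) deltahatE (bigD1_seq j) ?mem_index_iota ?iota_uniq //=.
  rewrite ltr_pwDl // big_seq_cond sumr_ge0 // => i /andP[].
  by rewrite mem_index_iota => /andP[_ im] _; apply: gamma_ge0.
by rewrite -ltnS qj.
Qed.

(** The value [g q.-1] is [gamma q], the least of the leading eigenvalues. The mean of the others
    lies strictly below it, since none exceeds it and one is strictly smaller. *)
Lemma deltahat_lt k : (k < q)%N -> dh < g k.
Proof.
move=> kq; suff : dh < g q.-1.
  move=> /lt_le_trans; apply; apply: gamma_anti.
  by rewrite (leq_ltn_trans (leq_pred q) qm) andbT -ltnS prednK.
case: gap => -[|j] [/andP[qj jm] gjq _] //.
rewrite -(ltr_pM2l mq_gt0) deltahatE /g prednK //.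
have -> : (m%:R - q%:R) * gamma q = \sum_(q <= i < m) gamma q.
  by rewrite sumr_const_nat -natrB ?(ltnW qm) // mulr_natl.
rewrite (bigD1_seq j) ?mem_index_iota ?iota_uniq //=; last by rewrite -ltnS qj.
rewrite [ltRHS](bigD1_seq j) ?mem_index_iota ?iota_uniq //=; last by rewrite -ltnS qj.
rewrite ltr_leD // big_seq_cond [leRHS]big_seq_cond ler_sum // => i /andP[].
rewrite mem_index_iota => /andP[qi im] _; rewrite -[q in leRHS]prednK //.
by apply: gamma_anti; rewrite im (leq_trans (leq_pred q)).
Qed.

(** All gap terms vanish: eigenvector columns give [s k = g k], and the choice of [a] gives
    [a k + delta = g k]. *)
Lemma solution_value (x : 'M[R]_(m, q) * R) : solutions S gamma x ->
  objF S x = minF q S g dh /\ objG S x = minG m q g dh.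
Proof.
case=> U [V [[UU SU] VV ->]]; rewrite Ahat_svd.
pose a k := g k - dh.
have a_ge0 k : (k < q)%N -> 0 <= a k.
  by move=> kq; rewrite subr_ge0 ltW // deltahat_lt.
have g_gt0 k : (k < q)%N -> 0 < g k.
  by move=> kq; rewrite (lt_trans deltahat_gt0) // deltahat_lt.
have sE (k : 'I_q) : g k - (U^T *m S *m U) k k = 0.
  by rewrite -mulmxA SU mulmxA UU mul1mx !mxE eqxx subrr.
split.
  rewrite (objF_gap dh UU VV a_ge0 mxtrace_gamma) subrr !big1 => [|k _|k _].
  - by rewrite expr0n !mulr0 !addr0.
  - by rewrite sE mulr0.
  - by rewrite /a subrK subrr expr0n.
rewrite (objG_gap UU VV a_ge0 mxtrace_gamma) ?deltahat_gt0 // !big1 => [|k _|k _].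
- by rewrite divff ?gt_eqF ?deltahat_gt0 // /gap_ln ln1 subrr subr0 mulr0 !addr0.
- by rewrite sE mulr0.
- by rewrite /a subrK divff ?gt_eqF ?g_gt0 // /gap_ln ln1 subrr subr0.
Qed.

Lemma solution_of_svd W (a : nat -> R) (P : 'M[R]_q) delta :
  W^T *m W = 1%:M -> P^T *m P = 1%:M ->
  S *m W = W *m diag_mx (\row_(k < q) g k) -> delta = dh ->
  (forall k, (k < q)%N -> a k + delta = g k) ->
  solutions S gamma
    (W *m diag_mx (\row_(k < q) Num.sqrt (a k)) *m P, delta).
Proof.
move=> WW PP SW -> ag; exists W, P; split=> //; rewrite Ahat_svd.
congr (_ *m diag_mx _ *m _, _); apply/rowP => k; rewrite !mxE.
by rewrite -/(g k) -ag // addrK.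
Qed.

Lemma objF_optimal (A : 'M[R]_(m, q)) delta : \rank A = q ->
  minF q S g dh <= objF S (A, delta) /\
  (objF S (A, delta) = minF q S g dh -> solutions S gamma (A, delta)).
Proof.
move=> /singular_value_decomposition[W [a [P [WW PP a_gt0 a_anti ->]]]].
have a_ge0 k : (k < q)%N -> 0 <= a k by move=> /a_gt0/ltW.
have [gap_ge0 gap_eq0] :=
  trace_gap (ltnW qm) Ssym char_poly_gamma gamma_anti a_anti a_gt0 WW.
rewrite (objF_gap delta WW PP a_ge0 mxtrace_gamma).
set u := \sum_(k < q) _ ^+ 2; set v := _ * (delta - dh) ^+ 2.
have u_ge0 : 0 <= u by apply: sumr_ge0 => k _; exact: sqr_ge0.
have v_ge0 : 0 <= v by rewrite mulr_ge0 ?sqr_ge0 // ltW // mq_gt0.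
split=> [|opt]; first lra.
have /eqP : u = 0 by lra.
rewrite psumr_eq0 => [/allP u0|k _]; last exact: sqr_ge0.
have ag k : (k < q)%N -> a k + delta = g k.
  move=> kq; apply/eqP; rewrite -subr_eq0 -sqrf_eq0.
  exact: (u0 (Ordinal kq) (mem_index_enum _)).
have /eqP : v = 0 by lra.
rewrite mulf_eq0 gt_eqF ?mq_gt0 //= sqrf_eq0 subr_eq0 => /eqP deltaE.
apply: solution_of_svd => //; apply: gap_eq0; last lra.
(* Since [a k + delta = g k], strict inequalities between eigenvalues pass to the weights. *)
by move=> k l kq lq; rewrite -!ag // ltrD2r.
Qed.

Lemma objG_optimal (A : 'M[R]_(m, q)) delta : \rank A = q -> 0 < delta ->
  minG m q g dh <= objG S (A, delta) /\
  (objG S (A, delta) = minG m q g dh -> solutions S gamma (A, delta)).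
Proof.
move=> /singular_value_decomposition[W [a [P [WW PP a_gt0 a_anti ->]]]] d_gt0.
have a_ge0 k : (k < q)%N -> 0 <= a k by move=> /a_gt0/ltW.
have ad_gt0 k : (k < q)%N -> 0 < a k + delta by move=> kq; rewrite addr_gt0 ?a_gt0.
(* These weights increase with [a k], so they inherit its order and its strict inequalities. *)
pose w k := delta^-1 - (a k + delta)^-1.
have w_lt k l : (k < q)%N -> (l < q)%N -> (w l < w k) = (a l < a k).
  by move=> kq lq; rewrite ltrD2l ltrN2 ltf_pV2 ?posrE ?ad_gt0 // ltrD2r.
have w_anti k l : (k <= l < q)%N -> w l <= w k.
  move=> /andP[kl lq]; rewrite leNgt w_lt ?(leq_ltn_trans kl) //.
  by rewrite -leNgt a_anti // kl.
have w_gt0 k : (k < q)%N -> 0 < w k.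
  move=> kq; rewrite subr_gt0 ltf_pV2 ?posrE ?ad_gt0 //.
  by rewrite ltrDr a_gt0.
have [gap_ge0 gap_eq0] :=
  trace_gap (ltnW qm) Ssym char_poly_gamma gamma_anti w_anti w_gt0 WW.
have g_gt0 k : (k < q)%N -> 0 < g k.
  by move=> kq; rewrite (lt_trans deltahat_gt0) // deltahat_lt.
rewrite (objG_gap WW PP a_ge0 mxtrace_gamma) ?deltahat_gt0 //.
set u := \sum_(k < q) gap_ln _; set v := _ * gap_ln _.
have u_ge0 (k : 'I_q) : 0 <= gap_ln (g k / (a k + delta)).
  by rewrite gap_ln_ge0 // divr_gt0 ?g_gt0 ?ad_gt0.
have v_ge0 : 0 <= v.
  by rewrite mulr_ge0 ?gap_ln_ge0 ?divr_gt0 ?deltahat_gt0 // ltW // mq_gt0.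
have usum_ge0 : 0 <= u by apply: sumr_ge0.
split=> [|opt]; first by rewrite lerDl addr_ge0 // addr_ge0.
have /eqP : u = 0 by rewrite /w in gap_ge0; lra.
rewrite psumr_eq0 // => /allP u0.
have ag k : (k < q)%N -> a k + delta = g k.
  move=> kq; have /eqP := u0 (Ordinal kq) (mem_index_enum _).
  move/gap_ln_eq0; rewrite /= divr_gt0 ?g_gt0 ?ad_gt0 // => /(_ isT) E.
  by rewrite -[LHS]mul1r -E divfK // gt_eqF // ad_gt0.
have /eqP : v = 0 by rewrite /w in gap_ge0; lra.
rewrite mulf_eq0 gt_eqF ?mq_gt0 //= => /eqP/gap_ln_eq0.
rewrite divr_gt0 ?deltahat_gt0 // => /(_ isT) E.
have deltaE : delta = dh by rewrite -[LHS]mul1r -E divfK // gt_eqF.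
apply: solution_of_svd => //; apply: gap_eq0; last by rewrite /w in gap_ge0 *; lra.
by move=> k l kq lq; rewrite w_lt // -!ag // ltrD2r.
Qed.

Lemma Ahat_feasible (b : 'cV[R]_m) U V : S *m b = 0 -> colorthonormal V ->
  top_eigenvectors S gamma U -> @feasible R m q b (Ahat gamma U V, dh).
Proof.
move=> Sb VV [UU SU]; have VV' : V *m V^T = 1%:M by exact: mulmx1C.
have g_gt0 (k : 'I_q) : 0 < g k.
  by rewrite (lt_trans deltahat_gt0) // deltahat_lt.
have diag_unit (v : 'rV[R]_q) : (forall k, 0 < v 0 k) -> diag_mx v \in unitmx.
  by move=> v_gt0; rewrite unitmxE det_diag unitfE gt_eqF // prodr_gt0.
split=> /=; first exact: deltahat_gt0.
  apply/eqP; rewrite eqn_leq rank_leq_col /=.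
  (* Multiplying by [U^T] leaves an invertible diagonal matrix times [V], which has rank [q]. *)
  apply: leq_trans (mxrankM_maxr U^T _); rewrite Ahat_svd !mulmxA UU mul1mx.
  rewrite mxrank_unit // unitmx_mul; apply/andP; split.
    apply: diag_unit => k; rewrite mxE sqrtr_gt0 subr_gt0.
    exact: deltahat_lt.
  by case/mulmx1_unit: VV'.
have Gunit : Gammaq q gamma \in unitmx by apply: diag_unit => k; rewrite mxE g_gt0.
(* Eigenvectors for nonzero eigenvalues are orthogonal to the kernel of the symmetric [S], which
   contains [b]. *)
have Ub : U^T *m b = 0.
  have : Gammaq q gamma *m (U^T *m b) = 0.
    have -> : Gammaq q gamma = (Gammaq q gamma)^T by rewrite tr_diag_mx.
    by rewrite mulmxA -trmx_mul -SU trmx_mul Ssym -mulmxA Sb mulmx0.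
  by move/(congr1 (mulmx (invmx (Gammaq q gamma)))); rewrite mulKmx // mulmx0.
by rewrite /Ahat !trmx_mul -!mulmxA Ub !mulmx0.
Qed.

End Optimality.

Theorem theorem1 (R : realType) (m p q : nat) (M : 'M[R]_m) (b : 'cV[R]_m)
    (hM : psdmx M) (hrank : \rank M = p) (hp : (1 < p <= m)%N)
    (hq0 : (0 < q)%N) (hq : (q < minn m p)%N)
    (hb0 : forall i, 0 <= b i 0)
    (hb : b = 0 \/ (b^T *m b) 0 0 = 1)
    (S : 'M[R]_m) (hS : S = centering b *m M *m (centering b)^T)
    (gamma : nat -> R) (hgamma : ordered_eigenvalues S gamma)
    (V : 'M[R]_q) (hV : colorthonormal V)
    (U : 'M[R]_(m, q)) (hU : top_eigenvectors S gamma U)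
    (hgap : exists j : nat,
       [/\ (q < j <= m)%N, gamma j < gamma q & 0 < gamma j]) :
  strict_local_min_modulo (@feasible R m q b) (@solutions R m q S gamma)
    (@objF R m q S) (Ahat gamma U V, deltahat m q gamma) /\
  strict_local_min_modulo (@feasible R m q b) (@solutions R m q S gamma)
    (@objG R m q S) (Ahat gamma U V, deltahat m q gamma).
Proof.
have [Msym M_psd] := hM.
have qm : (q < m)%N by move: hq; rewrite leq_min => /andP[].
have Ssym : S^T = S by rewrite hS !trmx_mul trmxK Msym mulmxA.
have S_psd (x : 'cV[R]_m) : 0 <= (x^T *m S *m x) 0 0.
  have := M_psd ((centering b)^T *m x).
  by rewrite hS trmx_mul trmxK !mulmxA.
have Sb : S *m b = 0 by rewrite hS -mulmxA centering_tr_mul // mulmx0.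
have Dx := Ahat_feasible qm Ssym S_psd hgamma hgap hq0 Sb hV hU.
have Ex : solutions S gamma (Ahat gamma U V, deltahat m q gamma).
  by exists U, V.
have value y := solution_value qm Ssym S_psd hgamma hgap hq0 (x := y).
split; apply: (strict_local_min_of_global Dx Ex).
- by move=> y /value[valF _]; exact: valF.
- by case=> A delta [_ rankA _]; apply: objF_optimal.
- by move=> y /value[_ valG]; exact: valG.
- by case=> A delta [d_gt0 rankA _]; apply: objG_optimal.
Qed.
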